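(* In $\mathsf{Partial}(\mathsf{BorelStoch})$, the integration map gives $\mathbb{R}_{\ge0}$ the structure of a partial algebra, defined on the distributions for which the integral is finite. That is, with $$D:=\Bigl\{p\in P\mathbb{R}_{\ge0} : \int_{\mathbb{R}_{\ge0}}x\,p(dx)<\infty\Bigr\},\qquad r\colon D\to\mathbb{R}_{\ge0},\quad r(p):=\int_{\mathbb{R}_{\ge0}}x\,p(dx),$$ the span $P\mathbb{R}_{\ge0}\hookleftarrow D\xrightarrow{r}\mathbb{R}_{\ge0}$ is a morphism of $\mathsf{Partial}(\mathsf{BorelStoch})_{\mathrm{cop}}$ which makes $\mathbb{R}_{\ge0}$ an algebra for the distribution monad $P$ on $\mathsf{Partial}(\mathsf{BorelStoch})_{\mathrm{cop}}$.
   Context: $\mathsf{BorelStoch}$ is the Markov category of standard Borel spaces and Markov kernels. Its partialization $\mathsf{Partial}(\mathsf{BorelStoch})$ has standard Borel spaces as objects; morphisms $X\to Y$ are isomorphism classes of spans $X\xleftarrow{i}D\xrightarrow{f}Y$ with $i$ an injective measurable map and $f$ a Markov kernel, i.e. pairs $(D,f)$ of a measurable subset $D\subseteq X$ and a Markov kernel $f\colon D\to Y$; composition is by pullback: the composite of $(D,f)\colon X\to Y$ and $(E,g)\colon Y\to Z$ has domain $\{x\in D: f(E\mid x)=1\}$ and is there given by composition of kernels. The subcategory $\mathsf{Partial}(\mathsf{BorelStoch})_{\mathrm{cop}}$ of copyable morphisms (those commuting with the copy maps) consists of the pairs $(D,f)$ with $D\subseteq X$ measurable and $f\colon D\to Y$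 a measurable map; composition is that of partial functions (the composite of $(D,f)$ and $(E,g)$ has domain $f^{-1}(E)$). The distribution monad $P$ on $\mathsf{Partial}(\mathsf{BorelStoch})_{\mathrm{cop}}$: $PX$ is the space of probability measures on $X$ with the Giry $\sigma$-algebra (generated by the maps $p\mapsto p(A)$, $A\subseteq X$ measurable). On a morphism $(D,f)\colon X\to Y$, $P(D,f)$ has domain $\{p\in PX:p(D)=1\}\cong PD$ and sends $p$ to the pushforward $f_*(p|_D)$. The unit is $\delta_X\colon x\mapsto\delta_x$ (Dirac measure) and the multiplication is $\mu_X\colon P^2X\to PX$, $\mu_X(\pi)(A)=\int_{PX}p(A)\,\pi(dp)$, both defined everywhere. A partial algebra is an Eilenberg–Moore algebra of this monad: an object $A$ with a morphism $\alpha\colon PA\to A$ of $\mathsf{Partial}(\mathsf{BorelStoch})_{\mathrm{cop}}$ such that $\alpha\circ\delta_A=\mathrm{id}_A$ and $\alpha\circ\mu_A=\alpha\circ P\alpha$ (equality as partial maps, including equality of domains). *)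

(* Defs.v *)
From HB Require Import structures.
From mathcomp Require Import all_boot all_order all_algebra.
From mathcomp Require Import all_classical all_reals all_analysis.
From mathcomp Require Import measurable_realfun.

Set Implicit Arguments.
Unset Strict Implicit.
Unset Printing Implicit Defensive.

Import Order.TTheory GRing.Theory Num.Theory.
Import numFieldNormedType.Exports.

Local Open Scope classical_set_scope.
Local Open Scope ring_scope.

(* A morphism of the category of copyable morphisms: a measurable subset D of X
   with a measurable map D -> Y. The map is stored as a total function (every
   measurableType is inhabited) whose values outside of D are irrelevant, so
   that morphisms have to be compared by pmfun_eq and not by =. Measurability of
   the restriction to D, for the sigma-algebra induced by X, is measurable_fun
   D. Nothing below depends on the spaces being standard Borel: those form a
   full subcategory, to which the distribution monad restricts. *)
Record pmfun d1 d2 (X : measurableType d1) (Y : measurableType d2) := PMFun {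
  pdom : set X;
  pfun : X -> Y;
  measurable_pdom : measurable pdom;
  measurable_pfun : measurable_fun pdom pfun }.

Definition pmfun_eq d1 d2 (X : measurableType d1) (Y : measurableType d2)
    (f g : pmfun X Y) : Prop :=
  pdom f = pdom g /\ {in pdom f, pfun f =1 pfun g}.

Definition pmfun_total d1 d2 (X : measurableType d1) (Y : measurableType d2)
    (f : X -> Y) (mf : measurable_fun [set: X] f) : pmfun X Y :=
  PMFun measurableT mf.

Definition pmfun_id d (X : measurableType d) : pmfun X X :=
  pmfun_total (@measurable_id _ X [set: X]).

Section composition.
Context d1 d2 d3 (X : measurableType d1) (Y : measurableType d2)
  (Z : measurableType d3).
Variables (g : pmfun Y Z) (f : pmfun X Y).

Let D : set X := pdom f `&` pfun f @^-1` pdom g.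

Let mD : measurable D.
Proof. by apply: measurable_pfun; exact: measurable_pdom. Qed.

Let mgf : measurable_fun D (pfun g \o pfun f).
Proof.
apply: (measurable_comp (measurable_pdom g)); last 2 first.
- exact: measurable_pfun.
- apply: (measurable_funS (measurable_pdom f)); last exact: measurable_pfun.
  exact: subIsetl.
by move=> _ [x [_ xg] <-].
Qed.

Definition pmfun_comp : pmfun X Z := PMFun mD mgf.

End composition.

(* The space PX of probability measures is the library's pprobability X R,
   whose sigma-algebra is generated by the sets {p | p(A) < r}, that is, by the
   evaluations at the measurable sets A. A library measure also has irrelevant
   values at the non-measurable sets, on which no definition below depends. *)

Section evaluation.
Context d (X : measurableType d) (R : realType).

Lemma measurable_pprobability_ev (A : set X) : measurable A ->
  measurable_fun [set: pprobability X R] (fun p => (p : probability X R) A : \bar R).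
Proof.
exact: (measurable_kernel (kprobability
  (@measurable_id _ (pprobability X R) [set: pprobability X R]))).
Qed.

Lemma measurable_fun_pprobability d' (W : measurableType d') (D : set W)
    (f : W -> pprobability X R) :
  (forall A, measurable A -> measurable_fun D (fun w => f w A)) ->
  measurable_fun D f.
Proof.
move=> mf mD; move: (mD).
apply: (measurability (@pset _ X R : set (set (pprobability X R)))) => //.
move=> _ -[_ [r r01] [A mA <-]] <-.
have -> : D `&` f @^-1` mset A r = D `&` (fun w => f w A) @^-1` `]-oo, r%:E[.
  by apply/seteqP; split=> w /=; rewrite /mset/= in_itv.
by apply: mf => //; exact: emeasurable_itv.
Qed.

End evaluation.

(* f_*(p|_D), for a probability measure p such that p(D) = 1. *)
Section pushforward_restriction.
Context d1 d2 (X : measurableType d1) (Y : measurableType d2) (R : realType).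
Variables (f : pmfun X Y) (p : probability X R).
Hypothesis p1 : p (pdom f) = 1%E.

Definition prestr (B : set Y) : \bar R := p (pdom f `&` pfun f @^-1` B).

Let prestr0 : prestr set0 = 0%E.
Proof. by rewrite /prestr preimage_set0 setI0 measure0. Qed.

Let prestr_ge0 B : (0 <= prestr B)%E.
Proof. exact: measure_ge0. Qed.

Let prestr_sigma_additive : semi_sigma_additive prestr.
Proof.
move=> F mF tF mUF; rewrite /prestr preimage_bigcup setI_bigcupr.
apply: measure_semi_sigma_additive.
- by move=> i; apply: measurable_pfun => //; exact: measurable_pdom.
- apply/trivIsetP => i j _ _ ij; rewrite setIACA setIid -preimage_setI.
  by move/trivIsetP : tF => /(_ i j I I ij) ->; rewrite preimage_set0 setI0.
- by apply: bigcup_measurable => i _;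
    apply: measurable_pfun => //; exact: measurable_pdom.
Qed.

HB.instance Definition _ := isMeasure.Build _ _ _ prestr
  prestr0 prestr_ge0 prestr_sigma_additive.

Let prestr_setT : prestr [set: Y] = 1%E.
Proof. by rewrite /prestr preimage_setT setIT. Qed.

HB.instance Definition _ := Measure_isProbability.Build _ _ _ prestr prestr_setT.

Definition pushforward_restr : probability Y R := prestr.

End pushforward_restriction.

Section distribution_monad.
Context (R : realType).

Section functor.
Context d1 d2 (X : measurableType d1) (Y : measurableType d2).
Variable f : pmfun X Y.

Definition dist_map_dom : set (pprobability X R) :=
  [set p : pprobability X R | p (pdom f) = 1%E].

(* The value point outside of dist_map_dom is irrelevant. *)
Definition dist_map_fun (p : pprobability X R) : pprobability Y R :=
  match pselect (p (pdom f) = 1%E) with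
  | left p1 => pushforward_restr p1
  | right _ => point
  end.

Lemma dist_map_funE p B : dist_map_dom p ->
  dist_map_fun p B = p (pdom f `&` pfun f @^-1` B).
Proof. by rewrite /dist_map_dom /dist_map_fun/=; case: pselect. Qed.

Lemma measurable_dist_map_dom : measurable dist_map_dom.
Proof.
have := measurable_pprobability_ev (R := R) (measurable_pdom f).
by move=> /(_ measurableT [set 1%E]); rewrite setTI; exact.
Qed.

Lemma measurable_dist_map_fun : measurable_fun dist_map_dom dist_map_fun.
Proof.
apply: measurable_fun_pprobability => B mB.
apply: (eq_measurable_fun
  (fun p : pprobability X R => p (pdom f `&` pfun f @^-1` B))).
  by move=> p; rewrite inE => /dist_map_funE ->.
apply: measurable_funTS; apply: measurable_pprobability_ev.
by apply: measurable_pfun => //; exact: measurable_pdom.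
Qed.

Definition dist_map : pmfun (pprobability X R) (pprobability Y R) :=
  PMFun measurable_dist_map_dom measurable_dist_map_fun.

End functor.

Section unit.
Context d (X : measurableType d).

Definition dist_ret (x : X) : pprobability X R := \d_x.

Lemma measurable_dist_ret : measurable_fun [set: X] dist_ret.
Proof.
by apply: measurable_fun_pprobability => A mA; exact: measurable_fun_dirac.
Qed.

Definition dist_unit : pmfun X (pprobability X R) :=
  pmfun_total measurable_dist_ret.

End unit.

Section multiplication.
Context d (X : measurableType d).

Section join.
Local Open Scope ereal_scope.
Variable q : pprobability (pprobability X R) R.

Definition pjoin (A : set X) : \bar R := \int[q]_p (p : probability X R) A.

Let pjoin0 : pjoin set0 = 0.
Proof. by rewrite /pjoin integral0_eq. Qed.

Let pjoin_ge0 A : 0 <= pjoin A.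
Proof. by rewrite /pjoin integral_ge0. Qed.

Let pjoin_sigma_additive : semi_sigma_additive pjoin.
Proof.
move=> F mF tF _; rewrite [X in _ --> X](_ : _ =
    \int[q]_p (\sum_(0 <= k <oo) (p : probability X R) (F k))); last first.
  apply: eq_integral => p _.
  by apply/esym/cvg_lim => //; exact: measure_sigma_additive.
rewrite [X in X @ _](_ : _ = (fun n =>
    \int[q]_p (\sum_(0 <= i < n) (p : probability X R) (F i)))); last first.
  apply/funext => n; rewrite -ge0_integral_sum//.
  by move=> ?; exact: measurable_pprobability_ev.
apply: cvg_monotone_convergence => //.
- by move=> n; apply: emeasurable_sum => m; exact: measurable_pprobability_ev.
- by move=> n x _; rewrite sume_ge0.
- by move=> x _ m n mn; exact: ereal_nondecreasing_series.
Qed.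

HB.instance Definition _ := isMeasure.Build _ _ _ pjoin
  pjoin0 pjoin_ge0 pjoin_sigma_additive.

Let pjoin_setT : pjoin [set: X] = 1.
Proof.
rewrite /pjoin (eq_integral (cst 1)) => [|p _]; last exact: probability_setT.
by rewrite integral_cst// mul1e; exact: probability_setT.
Qed.

HB.instance Definition _ := Measure_isProbability.Build _ _ _ pjoin pjoin_setT.

Definition dist_join : pprobability X R := pjoin.

End join.

Lemma measurable_dist_join :
  measurable_fun [set: pprobability (pprobability X R) R] dist_join.
Proof.
apply: measurable_fun_pprobability => A mA.
have mev := measurable_pprobability_ev (R := R) mA.
pose k := kprobability (@measurable_id _ (pprobability (pprobability X R) R)
  [set: pprobability (pprobability X R) R]).
exact: (measurable_fun_integral_kernel (measurable_kernel k) _ mev).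
Qed.

Definition dist_mult :
    pmfun (pprobability (pprobability X R) R) (pprobability X R) :=
  pmfun_total measurable_dist_join.

End multiplication.

Definition partial_algebra d (A : measurableType d)
    (alpha : pmfun (pprobability A R) A) : Prop :=
  pmfun_eq (pmfun_comp alpha (dist_unit A)) (pmfun_id A) /\
  pmfun_eq (pmfun_comp alpha (dist_mult A))
          (pmfun_comp alpha (dist_map alpha)).

End distribution_monad.

Section nonnegative_reals.
Context (R : realType).

Definition nnR : Type := {nonneg R}.
HB.instance Definition _ := Choice.copy nnR {nonneg R}.
HB.instance Definition _ := isPointed.Build nnR (0%:nng : {nonneg R}).

Definition nnval (x : nnR) : R := (x : {nonneg R})%:num.

(* R_{>=0} with its Borel sets, which are the traces of those of R. *)
Definition nnreal : measurableType (preimage_display nnval) :=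
  g_sigma_algebra_preimageType nnval.

(* The integral of x p(dx) in [0, +oo]. *)
Definition mean (p : pprobability nnreal R) : \bar R :=
  (\int[p]_x (nnval x)%:E)%E.

Definition mean_dom : set (pprobability nnreal R) :=
  [set p | (mean p < +oo)%E].

Lemma mean_ge0 p : (0 <= mean p)%E.
Proof. by apply: integral_ge0 => x _; rewrite lee_fin /nnval. Qed.

(* r on mean_dom, and 0 outside of it. *)
Definition mean_fun (p : pprobability nnreal R) : nnreal :=
  NngNum (fine_ge0 (mean_ge0 p)).

End nonnegative_reals.

(* Main.v *)
Require Import Defs.
From mathcomp Require Import all_boot all_order all_algebra.
From mathcomp Require Import all_classical all_reals all_analysis.
From mathcomp Require Import measurable_realfun.

Set Implicit Arguments.
Unset Strict Implicit.
Unset Printing Implicit Defensive.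

Import Order.TTheory GRing.Theory Num.Theory.

Local Open Scope classical_set_scope.
Local Open Scope ring_scope.
Local Open Scope ereal_scope.

(** The nonnegative reals form a partial algebra because the mean is an
    integral: both sides of the associativity law are, for a distribution q on
    distributions, the iterated integral of mean p against q(dp), with values
    in [0, +oo].

    On the side of the multiplication this is a Fubini-type identity: averaging
    the distributions p against q is a composition of kernels, and integration
    against a composite kernel is iterated integration ([integral_dist_join]).
    On the side of the functor it is the change of variables formula for the
    partial map [mean_fun] ([integral_pushforward_restr]), together with the
    fact that replacing the mean by its finite part changes nothing on
    [mean_dom].

    What has to be compared with care is the domains. The composite with the
    multiplication asks for the iterated integral to be finite; the composite
    with the functor asks in addition that q be concentrated on the p of finite
    mean. A nonnegative function of finite integral is finite almost
    everywhere, so that the second condition follows from the first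
    ([mean_dom_full]). The unit law says that the mean of a Dirac measure is
    its atom, and the measurability of the domain and of the mean comes from
    that of p |-> \int g dp in the Giry sigma-algebra. *)

(** * Integration against the distributions built by the monad *)

Lemma probability_full_setC d (T : measurableType d) (R : realType)
    (P : probability T R) (D : set T) :
  measurable D -> P D = 1 -> P (~` D) = 0.
Proof. by move=> mD P1; rewrite probability_setC// P1 subee. Qed.

Lemma ge0_integral_full_set d (T : measurableType d) (R : realType)
    (P : probability T R) (D : set T) (g : T -> \bar R) :
  measurable D -> P D = 1 -> measurable_fun [set: T] g ->
  (forall x, 0 <= g x) ->
  \int[P]_x g x = \int[P]_(x in D) g x.
Proof.
move=> mD P1 mg g0.
rewrite (@ge0_negligible_integral _ _ _ _ _ (~` D))//; last 2 first.
- exact: measurableC.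
- exact: probability_full_setC.
by rewrite setTD setCK.
Qed.

(** Change of variables along a partial map. To reduce to the formula for
    total maps, f is extended by a constant outside of its domain; this affects
    neither side, as p is concentrated on the domain. *)
Lemma integral_pushforward_restr d1 d2 (X : measurableType d1)
    (Y : measurableType d2) (R : realType) (f : pmfun X Y)
    (p : probability X R) (p1 : p (pdom f) = 1) (g : Y -> \bar R) :
  (forall y, 0 <= g y) -> measurable_fun [set: Y] g ->
  \int[pushforward_restr p1]_y g y = \int[p]_(x in pdom f) g (pfun f x).
Proof.
move=> g0 mg; have mD := measurable_pdom f.
pose h x := if x \in pdom f then pfun f x else point.
have mh : measurable_fun [set: X] h.
  apply: measurable_fun_if => //.
  - by apply: (measurable_fun_bool true); rewrite setTI preimage_mem_true.
  - by rewrite setTI preimage_mem_true; exact: measurable_pfun.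
have hD x : pdom f x -> h x = pfun f x by move=> Dx; rewrite /h mem_set.
transitivity (\int[pushforward p h]_y g y).
  apply: (@eq_measure_integral _ _ _ _ (pushforward p h)) => B mB _.
  have mhB : measurable (h @^-1` B) by rewrite -(setTI (_ @^-1` _)); exact: mh.
  have hBD0 : p (h @^-1` B `\` pdom f) = 0.
    apply: (@subset_measure0 _ _ _ p _ (~` pdom f)) => //.
    - exact: measurableD.
    - exact: measurableC.
    - exact: probability_full_setC.
  rewrite /pushforward_restr/= /prestr/= /pushforward (measureDI p mhB mD).
  rewrite [X in _ = X + _]hBD0 add0e; congr (p _); apply/seteqP.
  split => x /= []; first by move=> Dx fBx; split=> //; rewrite hD.
  by move=> hBx Dx; split=> //; rewrite -hD.
rewrite ge0_integral_pushforward// preimage_setT.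
rewrite (ge0_integral_full_set mD p1)//=; last exact: measurableT_comp.
by apply: eq_integral => x /[!inE] Dx; rewrite /= hD.
Qed.

Section join.
Context d (X : measurableType d) (R : realType).
Implicit Type g : X -> \bar R.

Lemma measurable_integral_pprobability g :
  (forall x, 0 <= g x) -> measurable_fun [set: X] g ->
  measurable_fun [set: pprobability X R]
    (fun p => \int[(p : probability X R)]_x g x).
Proof.
by move=> g0 mg; apply: measurable_fun_integral_kernel => // U mU;
  exact: measurable_pprobability_ev.
Qed.

(** The multiplication is a composition of kernels: the first one sends q, as a
    point, to q as a measure, and the second one does the same for p. *)
Lemma integral_dist_join (q : pprobability (pprobability X R) R) g :
  (forall x, 0 <= g x) -> measurable_fun [set: X] g ->
  \int[(dist_join q : probability X R)]_x g x =
  \int[q]_p \int[(p : probability X R)]_x g x.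
Proof.
move=> g0 mg.
pose l := kprobability (@measurable_id _ (pprobability (pprobability X R) R)
  [set: _]).
(* A second kernel may depend on q as well as on p, hence the projection. *)
pose k := kprobability (@measurable_snd _ _
  (pprobability (pprobability X R) R) (pprobability X R)).
exact: (integral_kcomp l k q g0 mg).
Qed.

End join.

(** * The mean as a partial map *)

Section nonnegative_reals.
Context (R : realType).

Lemma measurable_nnval : measurable_fun [set: nnreal R] (@nnval R).
Proof. by move=> _ B mB; exists B. Qed.

Lemma measurable_fun_nnreal d (W : measurableType d) (D : set W)
    (f : W -> nnreal R) :
  measurable_fun D (@nnval R \o f) -> measurable_fun D f.
Proof.
by move=> mf mD _ [B mB <-]; rewrite setTI -comp_preimage; exact: mf.
Qed.

Let nnval0 (x : nnreal R) : 0 <= (nnval x)%:E.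
Proof. by rewrite lee_fin /nnval. Qed.

Let measurable_EFin_nnval :
  measurable_fun [set: nnreal R] (fun x => (nnval x)%:E).
Proof. exact/measurable_EFinP/measurable_nnval. Qed.

Lemma measurable_mean :
  measurable_fun [set: pprobability (nnreal R) R] (@mean R).
Proof. exact: measurable_integral_pprobability. Qed.

Lemma measurable_mean_dom : measurable (@mean_dom R).
Proof.
rewrite (_ : @mean_dom R = [set: _] `&` [set p | mean p \is a fin_num]).
  by apply: emeasurable_fin_num => //; exact: measurable_mean.
rewrite setTI; apply/seteqP.
by split => p; rewrite /mean_dom/= ge0_fin_numE// mean_ge0.
Qed.

Lemma measurable_mean_fun : measurable_fun (@mean_dom R) (@mean_fun R).
Proof.
apply: measurable_funTS; apply: measurable_fun_nnreal.
exact: measurableT_comp (fine_measurable _) measurable_mean.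
Qed.

Definition mean_pmfun : pmfun (pprobability (nnreal R) R) (nnreal R) :=
  PMFun measurable_mean_dom measurable_mean_fun.

(** * The algebra laws *)

Lemma mean_dist_ret (x : nnreal R) : mean (dist_ret R x) = (nnval x)%:E.
Proof. by rewrite /mean integral_dirac// diracT mul1e. Qed.

Lemma EFin_mean_fun p :
  mean_dom p -> (nnval (mean_fun p))%:E = mean p :> \bar R.
Proof. by move=> Dp; rewrite fineK// ge0_fin_numE// mean_ge0. Qed.

Lemma mean_dist_join (q : pprobability (pprobability (nnreal R) R) R) :
  mean (dist_join q) = \int[q]_p mean p.
Proof. exact: integral_dist_join. Qed.

(** A nonnegative function of finite integral is finite almost everywhere. This
    is what makes the two domains of the associativity law agree. *)
Lemma mean_dom_full (q : pprobability (pprobability (nnreal R) R) R) :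
  \int[q]_p mean p < +oo -> q (@mean_dom R) = 1.
Proof.
move=> qoo; have mD := measurable_mean_dom.
have iq : q.-integrable [set: _] (@mean R).
  apply/integrableP; split; first exact: measurable_mean.
  by under eq_integral do rewrite gee0_abs ?mean_ge0//.
have qDC0 : q (~` @mean_dom R) = 0.
  apply/negligibleP; first exact/measurableC.
  apply: negligibleS (integrable_ae measurableT iq) => p /= Dp /(_ I).
  by rewrite ge0_fin_numE ?mean_ge0.
by rewrite -[@mean_dom R]setCK probability_setC ?qDC0 ?sube0//;
  exact/measurableC.
Qed.

Lemma mean_dist_map (q : pprobability (pprobability (nnreal R) R) R) :
  q (@mean_dom R) = 1 ->
  mean (dist_map_fun mean_pmfun q) = \int[q]_p mean p.
Proof.
move=> q1; rewrite /dist_map_fun; case: pselect => // q1'.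
rewrite /mean [LHS]integral_pushforward_restr//=.
rewrite [RHS](ge0_integral_full_set measurable_mean_dom q1); last 2 first.
- exact: measurable_mean.
- exact: mean_ge0.
by apply: eq_integral => p /[!inE]; exact: EFin_mean_fun.
Qed.

Lemma mean_fun_eq p p' :
  mean p = mean p' -> mean_fun p = mean_fun p' :> nnreal R.
Proof. by move=> pp'; apply: val_inj; rewrite /= pp'. Qed.

Lemma mean_partial_algebra : partial_algebra mean_pmfun.
Proof.
split; split => /=.
- rewrite setTI; apply/seteqP; split => // x _.
  by rewrite /mean_dom/= mean_dist_ret ltry.
- by move=> x _; apply: val_inj; rewrite /= mean_dist_ret.
- rewrite setTI; apply/seteqP; split => q /=;
    rewrite /mean_dom/= mean_dist_join.
    move=> qoo; have q1 := mean_dom_full qoo.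
    by split=> //; rewrite mean_dist_map.
  by case=> q1; rewrite mean_dist_map.
- move=> q; rewrite inE/= /mean_dom/= mean_dist_join => -[_ qoo].
  apply: mean_fun_eq; rewrite mean_dist_join mean_dist_map//.
  exact: mean_dom_full.
Qed.

End nonnegative_reals.

Theorem proposition4p8 (R : realType) :
  exists (mD : measurable (@mean_dom R))
         (mr : measurable_fun (@mean_dom R) (@mean_fun R)),
    partial_algebra (PMFun mD mr).
Proof.
exists (@measurable_mean_dom R), (@measurable_mean_fun R).
exact: mean_partial_algebra.
Qed.
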